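(* There exist constants $\varepsilon,\delta>0$ such that every (randomized) $(1-\varepsilon)$-approximation algorithm for the max ones problem has Lipschitz constant $\Omega(n^{\delta})$, where $n$ is the number of variables; i.e., there are instances with $n$ variables (for infinitely many/all large $n$) on which the Lipschitz constant of the algorithm, with respect to changes of the weight function for the fixed 3CNF formula, is at least $c\,n^{\delta}$ for a constant $c>0$.
   Context: Max ones problem: an instance is a 3CNF formula $\Phi$ over a variable set $X$ and a weight function $w:X\to\mathbb{R}_{\ge0}$; a solution is a satisfying assignment $\sigma:X\to\{0,1\}$, identified with the set $\sigma^{-1}(1)$, and the objective is to maximize $w(\sigma^{-1}(1))=\sum_{x\in\sigma^{-1}(1)}w(x)$. A $(1-\varepsilon)$-approximation algorithm always outputs a satisfying assignment whose expected weight is at least $(1-\varepsilon)$ times the optimum. Weighted Hamming distance: for $A,A'\subseteq X$ and $w,w'$, $d_{\mathrm w}((A,w),(A',w'))=\sum_{x\in A\cap A'}|w(x)-w'(x)|+\sum_{x\in A\setminus A'}w(x)+\sum_{x\in A'\setminus A}w'(x)$; $\mathrm{EM}$ is the infimum over couplings of the output distributions of the expected $d_{\mathrm w}$. The Lipschitz constant of algorithm $\mathcal A$ on formula $\Phi$ is $\sup_{w\neq w'}\mathrm{EM}((\mathcal A(\Phi,w),w),(\mathcal A(\Phi,w'),w'))/\|w-w'\|_1$, with $\mathcal A(\Phi,w)$ the distribution of $\sigma^{-1}(1)$. *)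

(* Defs.v *)
From HB Require Import structures.
From mathcomp Require Import all_boot all_order all_algebra.
From mathcomp Require Import all_classical all_reals.
From mathcomp Require Import ereal exp.
Set Implicit Arguments. Unset Strict Implicit. Unset Printing Implicit Defensive.
Import Order.TTheory GRing.Theory Num.Theory.
Local Open Scope ring_scope.
Local Open Scope classical_set_scope.

(* A literal over variables 'I_n: (x, b) means x if b = true, ~x if b = false. *)
Definition literal (n : nat) := ('I_n * bool)%type.
Definition clause (n : nat) := 3.-tuple (literal n).
Definition cnf3 (n : nat) := seq (clause n).

(* Assignments are identified with the set sigma^{-1}(1). *)
Definition lit_sat n (S : {set 'I_n}) (l : literal n) : bool := (l.1 \in S) == l.2.
Definition clause_sat n (S : {set 'I_n}) (C : clause n) : bool := has (lit_sat S) C.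
Definition sat n (Phi : cnf3 n) (S : {set 'I_n}) : bool := all (clause_sat S) Phi.
Definition satisfiable n (Phi : cnf3 n) : Prop := exists S, sat Phi S.

Section Defs.
Variable R : realType.

Definition nonneg_weight n (w : 'I_n -> R) : Prop := forall i, 0 <= w i.

Definition wsum n (w : 'I_n -> R) (S : {set 'I_n}) : R := \sum_(x in S) w x.

Definition opt n (Phi : cnf3 n) (w : 'I_n -> R) : R :=
  \big[Num.max/0]_(S : {set 'I_n} | sat Phi S) wsum w S.

(* A randomized algorithm: on input (Phi, w) it outputs a probability mass
   function on assignments {set 'I_n}. *)
Definition algorithm := forall n : nat, cnf3 n -> ('I_n -> R) -> {set 'I_n} -> R.

Definition is_pmf (T : finType) (p : T -> R) : Prop :=
  (forall t, 0 <= p t) /\ \sum_t p t = 1.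

Definition approx_algorithm (eps : R) (A : algorithm) : Prop :=
  forall n (Phi : cnf3 n) (w : 'I_n -> R),
    satisfiable Phi -> nonneg_weight w ->
    [/\ is_pmf (A n Phi w),
        (forall S, ~~ sat Phi S -> A n Phi w S = 0) &
        \sum_S A n Phi w S * wsum w S >= (1 - eps) * opt Phi w].

Definition dw n (S : {set 'I_n}) (w : 'I_n -> R) (S' : {set 'I_n}) (w' : 'I_n -> R) : R :=
  \sum_(x in S :&: S') `|w x - w' x|
  + \sum_(x in S :\: S') w x + \sum_(x in S' :\: S) w' x.

Definition coupling (T : finType) (p q : T -> R) (pi : T * T -> R) : Prop :=
  [/\ forall ab, 0 <= pi ab,
      forall a, \sum_b pi (a, b) = p a &
      forall b, \sum_a pi (a, b) = q b].

Definition EM n (p : {set 'I_n} -> R) (w : 'I_n -> R)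
                (q : {set 'I_n} -> R) (w' : 'I_n -> R) : R :=
  inf [set \sum_(ab : {set 'I_n} * {set 'I_n}) pi ab * dw ab.1 w ab.2 w'
      | pi in [set pi | coupling p q pi]].

Definition norm1 n (v : 'I_n -> R) : R := \sum_i `|v i|.

Definition lipschitz_const (A : algorithm) n (Phi : cnf3 n) : \bar R :=
  ereal_sup [set r : \bar R | exists (w w' : 'I_n -> R),
      [/\ nonneg_weight w, nonneg_weight w', w <> w' &
       r = ((EM (A n Phi w) w (A n Phi w') w') /
             norm1 (fun i => w i - w' i))%:E]].
End Defs.

(* Main.v *)
Require Import Defs.
From HB Require Import structures.
From mathcomp Require Import all_boot all_order all_algebra.
From mathcomp Require Import all_classical all_reals.
From mathcomp Require Import ereal exp.
From mathcomp Require Import zify ring lra.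
Import Order.TTheory GRing.Theory Num.Theory.
Local Open Scope ring_scope.

(** Let the satisfying assignments encode the words of a binary linear code of
length m = 4k that is maximal among those of minimum distance k; it then has
covering radius less than k. For a word y let the weight be the indicator of the
literals (i, y_i), so that the weight of a codeword c is its number of agreements
with y, and the optimum is at least 3k. Put s_i(y, c) = 1 if y_i = c_i and -1
otherwise. A 5/6-approximation has expected value of sum_i s_i(y, c) at least
2 (5/6) 3k - 4k = k. Since flipping y_i negates s_i, summing
E_y s_i(y, c) - E_{y + e_i} s_i(y, c) over all y and i gives twice the sum over y
of these expectations, so for some y and i the difference is at least 1/2. Hence
any coupling of the outputs at y and y + e_i moves mass at least 1/4 between
distinct codewords, at cost at least k - 1 each, while the weights differ by 2 in
the 1-norm. With k^2 proportional to n this gives a bound of order sqrt n. *)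

(** * Binary linear codes *)

Definition hamming_weight {m : nat} (v : 'rV[bool]_m) : nat := #|[set i | v 0 i]|.

(** [bool] serves as the field with two elements and the code is the row space of [A]; by linearity
    its minimum distance is its least nonzero weight. *)
Definition min_distance_ge {m : nat} (d : nat) (A : 'M[bool]_m) : bool :=
  [forall v : 'rV[bool]_m, (v <= A)%MS ==> (v != 0) ==> (d <= hamming_weight v)%N].

Lemma min_distance_geP m d (A : 'M[bool]_m) :
  reflect (forall v : 'rV[bool]_m, (v <= A)%MS -> v != 0 -> (d <= hamming_weight v)%N)
    (min_distance_ge d A).
Proof.
apply: (iffP forallP) => [h v vA v0|h v]; first by have := h v; rewrite vA v0.
by apply/implyP => vA; apply/implyP => v0; exact: h.
Qed.

Lemma hamming_weight0 m : @hamming_weight m 0 = 0%N.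
Proof. by apply: eq_card0 => i; rewrite inE mxE. Qed.

(* A word at distance at least d from a linear code of minimum distance d could
   be added to it, so a maximal such code has covering radius less than d. *)
Lemma linear_code_exists (m d : nat) : (0 < d)%N ->
  exists2 A : 'M[bool]_m, min_distance_ge d A &
    forall y : 'rV[bool]_m, exists2 v : 'rV[bool]_m,
      (v <= A)%MS & (hamming_weight (v + y) < d)%N.
Proof.
move=> d0.
have code0 : min_distance_ge d (0 : 'M[bool]_m).
  by apply/min_distance_geP => v; rewrite submx0 => /eqP ->; rewrite eqxx.
case: (arg_maxnP (fun A : 'M[bool]_m => \rank A) code0) => A codeA maxA.
exists A => // y.
have [/existsP[v /andP[vA vy]]|] :=
  boolP [exists v : 'rV[bool]_m, (v <= A)%MS && (hamming_weight (v + y) < d)%N].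
  by exists v.
rewrite negb_exists => /forallP far.
have {}far v : (v <= A)%MS -> (d <= hamming_weight (v + y))%N.
  by move=> vA; have := far v; rewrite vA /= -leqNgt.
have yA : ~~ (y <= A)%MS.
  apply/negP => /far.
  have -> : y + y = 0 by apply/matrixP => i j; rewrite !mxE; case: (y i j).
  by rewrite hamming_weight0 leqNgt d0.
have : min_distance_ge d (A + y)%MS.
  apply/min_distance_geP => v /sub_addsmxP[[u t] /= ->] v0.
  (* The scalar [t] is 1 or 0, so the word is a codeword plus [y] or a codeword. *)
  move: v0; rewrite [t]mx11_scalar mul_scalar_mx.
  case: (t 0 0) => v0.
    by rewrite (_ : true = 1) // scale1r; apply: far; exact: submxMl.
  move: v0; rewrite (_ : false = 0) // scale0r addr0 => v0.
  by apply: (min_distance_geP _ _ _ codeA); rewrite ?submxMl.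
(* By maximality the rank does not grow, which would put [y] in the code. *)
move/maxA; rewrite /geq /= => rk.
have := mxrank_leqif_sup (addsmxSl A y) => /leqifP.
case: ifP => [|_]; last by rewrite ltnNge rk.
by rewrite addsmx_sub => /andP[_ yA']; rewrite yA' in yA.
Qed.

(** * Encoding a code by a 3CNF formula *)

(** Full conjunctive normal form: each triple of values violating [P] is excluded by its own clause.
    Constraints on two variables repeat an argument. *)
Definition ternary_cnf {n : nat} (P : bool -> bool -> bool -> bool) (a b c : 'I_n) : cnf3 n :=
  [seq [tuple (a, ~~ t.1.1); (b, ~~ t.1.2); (c, ~~ t.2)] |
     t <- [seq t <- enum {: bool * bool * bool} | ~~ P t.1.1 t.1.2 t.2]].

Lemma sat_ternary_cnf n P (a b c : 'I_n) S :
  sat (ternary_cnf P a b c) S = P (a \in S) (b \in S) (c \in S).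
Proof.
rewrite /sat all_map; apply/allP/idP => [h|Pabc [[x y] z]].
  have [//|nP] := boolP (P (a \in S) (b \in S) (c \in S)).
  have /h : (a \in S, b \in S, c \in S) \in
      [seq t <- enum {: bool * bool * bool} | ~~ P t.1.1 t.1.2 t.2].
    by rewrite mem_filter /= nP mem_enum.
  by rewrite /clause_sat /= /lit_sat /=; do 3!case: (_ \in S).
rewrite mem_filter /= => /andP[nP _]; rewrite /clause_sat /= /lit_sat /=.
by move: nP Pabc; case: (a \in S) (b \in S) (c \in S) x y z => [] [] [] [] [] [] // /negP.
Qed.

Lemma sat_flatten n (I : finType) (F : I -> cnf3 n) S :
  sat (flatten [seq F i | i <- enum I]) S = [forall i, sat (F i) S].
Proof.
have -> : sat (flatten [seq F i | i <- enum I]) S = all (fun i => sat (F i) S) (enum I).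
  by elim: (enum I) => //= i s <-; rewrite /sat all_cat.
apply/allP/forallP => h i; last by move=> _; exact: h.
by apply: h; rewrite mem_enum.
Qed.

Lemma injection_into_ord (V : finType) (n : nat) : (#|V| <= n)%N ->
  exists f : V -> 'I_n, injective f.
Proof.
move=> Vn; exists (fun v => widen_ord Vn (enum_rank v)) => u v /(congr1 val) /= uv.
exact/enum_rank_inj/val_inj.
Qed.

Definition codeword {m n : nat} (x : 'I_m -> bool -> 'I_n) (S : {set 'I_n}) : 'rV[bool]_m :=
  \row_i (x i true \in S).

(* Besides a variable for each x_i and its complement, the formula has a variable
   for each partial sum of each parity check of the code. *)
Lemma linear_code_cnf (m n : nat) (A : 'M[bool]_m) : (m * 2 + m * m.+1 <= n)%N ->
  exists (x : 'I_m -> bool -> 'I_n) (Phi : cnf3 n),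
    [/\ forall i, x i true != x i false,
        forall S, sat Phi S ->
          (forall i b, (x i b \in S) = ((x i true \in S) == b)) /\
          (codeword x S <= A)%MS &
        forall v : 'rV[bool]_m, (v <= A)%MS ->
          exists2 S, sat Phi S & forall i, (x i true \in S) = v 0 i].
Proof.
move=> mn; pose V := ('I_m * bool + 'I_m * 'I_m.+1)%type.
have [f finj] : exists f : V -> 'I_n, injective f.
  by apply: injection_into_ord; rewrite card_sum !card_prod !card_ord card_bool.
(* [x i b] says that coordinate [i] equals [b]; [s r k] stands for the sum of the terms of check [r]
   at coordinates below [k]. *)
pose x i b := f (inl (i, b)); pose s r k := f (inr (r, k)).
pose H := cokermx A.
pose wd := widen_ord (leqnSn m).
pose negc i := ternary_cnf (fun a b _ => a == ~~ b) (x i true) (x i false) (x i false).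
pose endc r := ternary_cnf (fun a b _ => ~~ a && ~~ b)
  (s r ord0) (s r ord_max) (s r ord_max).
pose stepc (p : 'I_m * 'I_m) := ternary_cnf (fun a b c => c == b (+) (a && H p.2 p.1))
  (x p.2 true) (s p.1 (wd p.2)) (s p.1 (lift ord0 p.2)).
pose Phi := flatten [seq negc i | i <- enum 'I_m] ++
  flatten [seq endc i | i <- enum 'I_m] ++
  flatten [seq stepc p | p <- enum {: 'I_m * 'I_m}].
have satE S : sat Phi S = [&& [forall i, sat (negc i) S], [forall r, sat (endc r) S] &
    [forall p, sat (stepc p) S]].
  by rewrite -!sat_flatten /sat !all_cat.
exists x, Phi; split.
- by move=> i; apply/eqP => /finj.
- move=> S; rewrite satE => /and3P[/forallP hneg /forallP hend /forallP hstep].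
  split=> [i []|]; first by case: (_ \in S).
    by have := hneg i; rewrite sat_ternary_cnf => /eqP ->; case: (_ \in S).
  rewrite submxE; apply/eqP/rowP => r; rewrite !mxE.
  (* With indices in [nat] the syndrome telescopes; only [k <= m] occurs, where [inord] is
     faithful. *)
  pose g k : bool := s r (inord k) \in S.
  have -> : \sum_j codeword x S 0 j * cokermx A j r =
      \sum_(i < m) (g i.+1 - g i).
    apply: eq_bigr => i _; rewrite mxE.
    have := hstep (r, i); rewrite sat_ternary_cnf /= => /eqP.
    rewrite (_ : lift ord0 i = inord i.+1); last first.
      by apply: val_inj; rewrite /= inordK ?ltnS.
    rewrite (_ : wd i = inord i); last first.
      by apply: val_inj; rewrite /= inordK // ltnS ltnW.
    rewrite -/(g i) -/(g i.+1) -/H => ->.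
    by case: (g i); case: (_ \in S); case: (H i r).
  rewrite -(big_mkord xpredT (fun i => g i.+1 - g i)) telescope_sumr //.
  have := hend r; rewrite sat_ternary_cnf => /andP[h0 hm].
  have -> : g 0%N = false.
    by apply/negbTE; rewrite /g (_ : inord 0 = ord0) //; apply: val_inj; rewrite /= inordK.
  have -> : g m = false.
    by apply/negbTE; rewrite /g (_ : inord m = ord_max) //; apply: val_inj; rewrite /= inordK.
  by [].
- move=> v; rewrite submxE => /eqP vH.
  pose sums r (k : nat) : bool := \sum_(i < m | (i < k)%N) v 0 i * H i r.
  pose val_of (u : V) : bool :=
    match u with inl (i, b) => v 0 i == b | inr (r, k) => sums r k end.
  pose S := [set f u | u in [pred u | val_of u]].
  have memS u : (f u \in S) = val_of u by rewrite mem_imset.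
  exists S; last by move=> i; rewrite memS /= eqb_id.
  rewrite satE; apply/and3P; split; apply/forallP.
  + by move=> i; rewrite sat_ternary_cnf !memS /=; case: (v 0 i).
  + move=> r; rewrite sat_ternary_cnf !memS /= /sums.
    rewrite big_pred0 //=.
    have := congr1 (fun M : 'rV__ => M 0 r) vH; rewrite !mxE => vHr.
    rewrite (eq_bigl xpredT); first by rewrite [X in ~~ X]vHr.
    by move=> i; rewrite ltn_ord.
  + move=> [r k]; rewrite sat_ternary_cnf !memS /= /sums eqb_id.
    rewrite (bigD1 k) /=; last by rewrite /bump /= add1n.
    rewrite (eq_bigl (fun i : 'I_m => (i < k)%N)); last first.
      by move=> i; rewrite -val_eqE /= /bump /= add1n ltnS [RHS]ltn_neqAle andbC.
    by rewrite addrC.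
Qed.

(** * Weights of words and transport cost *)

(** Coincidences count with multiplicity, so the weight of a set is exactly a number of indices
    [i]. *)
Definition word_weight (R : realType) {m n : nat} (x : 'I_m -> bool -> 'I_n)
    (y : 'rV[bool]_m) (j : 'I_n) : R :=
  \sum_i (x i (y 0 i) == j)%:R.

Lemma nonneg_word_weight (R : realType) m n (x : 'I_m -> bool -> 'I_n) y :
  nonneg_weight (word_weight R x y).
Proof. by move=> j; apply: sumr_ge0. Qed.

Lemma wsum_word_weight (R : realType) m n (x : 'I_m -> bool -> 'I_n) y (S : {set 'I_n}) :
  wsum (word_weight R x y) S = \sum_i (x i (y 0 i) \in S)%:R.
Proof.
rewrite /wsum /word_weight exchange_big /=; apply: eq_bigr => i _.
rewrite big_mkcond /= (bigD1 (x i (y 0 i))) //= eqxx big1 ?addr0.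
  by case: (_ \in S).
by move=> j /negbTE jx; rewrite eq_sym jx; case: (_ \in S).
Qed.

Definition flip {m : nat} (y : 'rV[bool]_m) (i : 'I_m) : 'rV[bool]_m := y + delta_mx 0 i.

Lemma flipE m (y : 'rV[bool]_m) i j : flip y i 0 j = y 0 j (+) (j == i).
Proof. by rewrite !mxE /=; case: (j == i). Qed.

Lemma flip_inj m (i : 'I_m) : injective (fun y : 'rV[bool]_m => flip y i).
Proof. exact: addIr. Qed.

(** The flip moves one unit of weight between the two distinct variables of coordinate [i].
    Positivity serves to divide by the norm. *)
Lemma norm1_flip (R : realType) m n (x : 'I_m -> bool -> 'I_n) y i :
  x i true != x i false ->
  0 < norm1 (fun j => word_weight R x y j - word_weight R x (flip y i) j) <= 2.
Proof.
move=> xi.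
have xy : x i (~~ y 0 i) != x i (y 0 i) by case: (y 0 i); rewrite // eq_sym.
have wE j : word_weight R x y j - word_weight R x (flip y i) j =
    (x i (y 0 i) == j)%:R - (x i (~~ y 0 i) == j)%:R.
  rewrite /word_weight -sumrB (bigD1 i) //= flipE eqxx addbT big1 ?addr0 //.
  by move=> k /negbTE ki; rewrite flipE ki addbF subrr.
apply/andP; split.
  rewrite /norm1 (bigD1 (x i (y 0 i))) //= wE eqxx (negbTE xy) subr0 normr1.
  by rewrite ltr_wpDr // sumr_ge0.
have sum1 (k : 'I_n) : \sum_j (k == j)%:R = 1 :> R.
  by rewrite (bigD1 k) //= eqxx big1 ?addr0 // => j /negbTE; rewrite eq_sym => ->.
rewrite /norm1 (_ : 2 = \sum_j ((x i (y 0 i) == j)%:R + (x i (~~ y 0 i) == j)%:R) :> R).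
  by apply: ler_sum => j _; rewrite wE (le_trans (ler_normB _ _)) // !normr_nat.
by rewrite big_split /= !sum1.
Qed.

Definition agreement_sign (R : realType) {m n : nat} (x : 'I_m -> bool -> 'I_n)
    (y : 'rV[bool]_m) (i : 'I_m) (S : {set 'I_n}) : R :=
  2 * (x i (y 0 i) \in S)%:R - 1.

Lemma sum_agreement_sign (R : realType) m n (x : 'I_m -> bool -> 'I_n) y (S : {set 'I_n}) :
  \sum_i agreement_sign R x y i S = 2 * wsum (word_weight R x y) S - m%:R.
Proof. by rewrite sumrB -mulr_sumr wsum_word_weight sumr_const card_ord. Qed.

Lemma agreement_sign_flip (R : realType) m n (x : 'I_m -> bool -> 'I_n) y i (S : {set 'I_n}) :
  (forall i b, (x i b \in S) = ((x i true \in S) == b)) ->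
  agreement_sign R x (flip y i) i S = - agreement_sign R x y i S.
Proof.
move=> hS; rewrite /agreement_sign flipE eqxx addbT hS [in RHS]hS.
by case: (y 0 i); case: (_ \in S) => /=; ring.
Qed.

(** At a coordinate [j] other than [i] where the codewords differ, the variable weighted by both
    words lies in exactly one of the sets and costs 1. Coordinate [i] may cost nothing, hence the
    loss of 1. *)
Lemma dw_flip_ge (R : realType) m n (x : 'I_m -> bool -> 'I_n) y i (S S' : {set 'I_n}) :
  (forall i b, (x i b \in S) = ((x i true \in S) == b)) ->
  (forall i b, (x i b \in S') = ((x i true \in S') == b)) ->
  (hamming_weight (codeword x S + codeword x S'))%:R - 1 <=
    dw S (word_weight R x y) S' (word_weight R x (flip y i)).
Proof.
move=> hS hS'; rewrite /dw -addrA.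
apply: ler_wpDl; first exact: sumr_ge0.
rewrite -!/(wsum _ _) !wsum_word_weight -big_split /=.
have -> : (hamming_weight (codeword x S + codeword x S'))%:R - 1 =
    \sum_j (((x j true \in S) (+) (x j true \in S'))%:R - (j == i)%:R) :> R.
  rewrite sumrB; congr (_ - _).
    rewrite /hamming_weight -sum1_card natr_sum big_mkcond /=; apply: eq_bigr => j _.
    by rewrite inE !mxE /= -[(_ + _)%R]/(_ (+) _); case: (_ (+) _).
  by rewrite (bigD1 i) //= eqxx big1 ?addr0 // => j /negbTE ->.
apply: ler_sum => j _; rewrite !inE flipE.
rewrite (hS _ (y 0 j)) (hS' _ (y 0 j)) (hS _ (y 0 j (+) _)) (hS' _ (y 0 j (+) _)).
by case: (_ \in S); case: (_ \in S'); case: (y 0 j); case: (j == i) => /=; lra.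
Qed.

(* The easy half of Kantorovich duality. *)
Lemma EM_ge (R : realType) n (P : pred {set 'I_n}) (p q : {set 'I_n} -> R) w w'
    (g : {set 'I_n} -> R) :
  is_pmf p -> is_pmf q ->
  (forall S, ~~ P S -> p S = 0) -> (forall S, ~~ P S -> q S = 0) ->
  (forall S S', P S -> P S' -> g S - g S' <= dw S w S' w') ->
  \sum_S (p S - q S) * g S <= Defs.EM p w q w'.
Proof.
move=> [p0 p1] [q0 q1] pP qP gd; apply: lb_le_inf.
  (* The product coupling shows that the infimum is over a nonempty set. *)
  exists (\sum_(ab : {set 'I_n} * {set 'I_n}) (p ab.1 * q ab.2) * dw ab.1 w ab.2 w').
  exists (fun ab => p ab.1 * q ab.2) => //; split=> [ab|a|b] /=.
  - by rewrite mulr_ge0.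
  - by rewrite -mulr_sumr q1 mulr1.
  - by rewrite -mulr_suml p1 mul1r.
move=> _ [pi [pi0 pil pir] <-].
have -> : \sum_S (p S - q S) * g S = \sum_ab pi ab * (g ab.1 - g ab.2).
  under eq_bigr do rewrite mulrBl.
  under [RHS]eq_bigr do rewrite mulrBr.
  rewrite !sumrB; congr (_ - _).
    under eq_bigr do rewrite -pil mulr_suml.
    by rewrite pair_bigA /=; apply: eq_bigr => -[].
  under eq_bigr do rewrite -pir mulr_suml.
  by rewrite exchange_big pair_bigA /=; apply: eq_bigr => -[].
apply: ler_sum => -[a b] _ /=.
(* Outside [P] a marginal vanishes, and with it [pi (a, b)]. *)
have [Pa|/pP pa0] := boolP (P a); last first.
  have -> : pi (a, b) = 0; last by rewrite !mul0r.
  apply/eqP; rewrite eq_le pi0 andbT -pa0 -pil (bigD1 b) //= lerDl sumr_ge0 //.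
have [Pb|/qP qb0] := boolP (P b); last first.
  have -> : pi (a, b) = 0; last by rewrite !mul0r.
  apply/eqP; rewrite eq_le pi0 andbT -qb0 -pir (bigD1 a) //= lerDl sumr_ge0 //.
by apply: ler_wpM2l => //; exact: gd.
Qed.

(** * Averaging over words and the lower bound *)

(** For fixed [i] the flip permutes the words, so after the sign change both halves of the
    difference have the same sum. Where the sign rule may fail, [p] vanishes. *)
Lemma sum_flip (R : realType) m n (x : 'I_m -> bool -> 'I_n) (Phi : cnf3 n)
    (p : 'rV[bool]_m -> {set 'I_n} -> R) :
  (forall S, sat Phi S -> forall i b, (x i b \in S) = ((x i true \in S) == b)) ->
  (forall y S, ~~ sat Phi S -> p y S = 0) ->
  \sum_y \sum_i \sum_S (p y S - p (flip y i) S) * agreement_sign R x y i S =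
  2 * \sum_y \sum_S p y S * (2 * wsum (word_weight R x y) S - m%:R).
Proof.
move=> xS pS; rewrite mulr_sumr exchange_big /=.
transitivity (\sum_i \sum_y 2 * \sum_S p y S * agreement_sign R x y i S).
  apply: eq_bigr => i _.
  under eq_bigr => y _ do (under eq_bigr => S _ do rewrite mulrBl).
  have -> : \sum_y \sum_S (p y S * agreement_sign R x y i S -
       p (flip y i) S * agreement_sign R x y i S) =
     \sum_y \sum_S p y S * agreement_sign R x y i S +
     \sum_y \sum_S p (flip y i) S * agreement_sign R x (flip y i) i S.
    rewrite -big_split; apply: eq_bigr => y _ /=.
    rewrite -big_split; apply: eq_bigr => S _ /=.
    have [/xS sS|nS] := boolP (sat Phi S); last by rewrite !(pS _ _ nS) !mul0r subrr addr0.
    by rewrite agreement_sign_flip // mulrN.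
  have <- : \sum_y \sum_S p y S * agreement_sign R x y i S =
      \sum_y \sum_S p (flip y i) S * agreement_sign R x (flip y i) i S.
    by rewrite (reindex_inj (@flip_inj m i)).
  by rewrite -mulr_sumr; ring.
rewrite exchange_big; apply: eq_bigr => y _ /=.
rewrite -mulr_sumr exchange_big /=; congr (_ * _); apply: eq_bigr => S _.
by rewrite -mulr_sumr sum_agreement_sign.
Qed.

Lemma dw_ge0 (R : realType) n (S S' : {set 'I_n}) (w w' : 'I_n -> R) :
  nonneg_weight w -> nonneg_weight w' -> 0 <= dw S w S' w'.
Proof. by move=> w0 w'0; rewrite /dw !addr_ge0 ?sumr_ge0. Qed.

Lemma lipschitz_const_lower_bound (R : realType) (Alg : algorithm R) (k n : nat) :
  approx_algorithm 6^-1 Alg -> (1 < k)%N -> (28 * k ^ 2 <= n)%N ->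
  exists Phi : cnf3 n, satisfiable Phi /\
    ((k%:R / 16)%:E <= lipschitz_const Alg Phi)%E.
Proof.
move=> approx k1 kn; pose m := (4 * k)%N.
have k0 : (0 < k)%N by exact: ltnW.
have k1R : 2 <= k%:R :> R by rewrite ler_nat.
have [C codeC coverC] := linear_code_exists m k k0.
(* The left side is [16 k^2 + 12 k], at most [28 k^2]. *)
have mn : (m * 2 + m * m.+1 <= n)%N by rewrite /m; nia.
have [x [Phi [x_neq satP satC]]] := linear_code_cnf m n C mn.
exists Phi.
have sat_ex : satisfiable Phi by have [S] := satC 0 (sub0mx _ _); exists S.
split=> //.
pose w := word_weight R x.
have w0 y : nonneg_weight (w y) by exact: nonneg_word_weight.
pose p y := Alg n Phi (w y).
have p_pmf y : is_pmf (p y) by have [] := approx n Phi (w y) sat_ex (w0 y).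
have p_sat y S : ~~ sat Phi S -> p y S = 0.
  by have [_ + _] := approx n Phi (w y) sat_ex (w0 y); exact.
have opt_ge y : 3 * k%:R <= opt Phi (w y).
  have [v vC vy] := coverC y; have [S sS Sv] := satC v vC.
  apply: le_trans (le_bigmax_cond _ _ sS).
  rewrite wsum_word_weight.
  have -> : \sum_i (x i (y 0 i) \in S)%:R = m%:R - (hamming_weight (v + y))%:R :> R.
    rewrite /hamming_weight -sum1_card natr_sum [X in _ - X]big_mkcond /=.
    have -> : m%:R = \sum_(i < m) 1 :> R by rewrite sumr_const card_ord.
    rewrite -sumrB; apply: eq_bigr => i _.
    rewrite (satP S sS).1 Sv inE !mxE /=.
    by case: (v 0 i); case: (y 0 i) => /=; rewrite ?subr0 ?subrr.
  rewrite lerBrDr -natrM -natrD ler_nat; move: vy; set h := hamming_weight _; lia.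
have gain y : k%:R <= \sum_S p y S * (2 * wsum (w y) S - m%:R).
  have -> : \sum_S p y S * (2 * wsum (w y) S - m%:R) =
      2 * (\sum_S p y S * wsum (w y) S) - m%:R.
    under eq_bigr do rewrite mulrBr mulrCA.
    by rewrite sumrB -mulr_sumr -mulr_suml (p_pmf y).2 mul1r.
  have [_ _] := approx n Phi (w y) sat_ex (w0 y); rewrite -/(p y).
  have := opt_ge y; rewrite /m natrM; lra.
pose G y i := \sum_S (p y S - p (flip y i) S) * agreement_sign R x y i S.
have [y [i Gyi]] : exists y i, 2^-1 <= G y i.
  (* Otherwise the [4k] terms for each [y] sum to less than [2k], against the average given by
     [sum_flip] and [gain]. *)
  apply: contrapT => noG.
  have Glt y i : G y i < 2^-1.
    by rewrite ltNge; apply/negP => Gyi; apply: noG; exists y, i.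
  have has_index (I : finType) (j : I) : has xpredT (index_enum I).
    by apply/hasP; exists j; rewrite ?mem_index_enum.
  have : \sum_y \sum_i G y i < \sum_(y : 'rV[bool]_m) 2 * k%:R.
    apply: ltr_sum => [|y _]; first exact: (has_index _ 0).
    have -> : 2 * k%:R = \sum_(i < m) 2^-1 :> R.
      by rewrite sumr_const card_ord -[RHS]mulr_natl natrM; field.
    apply: ltr_sum => [|i _]; last exact: Glt.
    have m0 : (0 < m)%N by rewrite muln_gt0.
    exact: (has_index _ (Ordinal m0)).
  rewrite (@sum_flip _ _ _ _ Phi) //; last by move=> S /satP[].
  by rewrite mulr_sumr ltNge ler_sum // => y _; rewrite ler_wpM2l.
(* The dual test function: its values are plus or minus [(k - 1) / 2], so it varies by at most
   [k - 1] between distinct codewords and not at all on equal ones. *)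
pose g S := (k%:R - 1) / 2 * agreement_sign R x y i S.
have EM_lb : (k%:R - 1) / 4 <= Defs.EM (p y) (w y) (p (flip y i)) (w (flip y i)).
  have : \sum_S (p y S - p (flip y i) S) * g S <=
      Defs.EM (p y) (w y) (p (flip y i)) (w (flip y i)).
    apply: EM_ge (p_pmf _) (p_pmf _) (p_sat _) (p_sat _) _ => S S' sS sS'.
    have [hS cS] := satP S sS; have [hS' cS'] := satP S' sS'.
    have [eqc|neqc] := eqVneq (codeword x S) (codeword x S').
      have eqi : (x i true \in S) = (x i true \in S').
        by have := congr1 (fun M : 'rV__ => M 0 i) eqc; rewrite !mxE.
      by rewrite /g /agreement_sign hS hS' eqi subrr dw_ge0.
    have := @dw_flip_ge R _ _ x y i S S' hS hS'.
    apply: le_trans.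
    have : (k <= hamming_weight (codeword x S + codeword x S'))%N.
      apply: (min_distance_geP _ _ _ codeC); first exact: addmx_sub.
      apply: contra neqc => /eqP e; apply/eqP/rowP => j.
      have := congr1 (fun M : 'rV__ => M 0 j) e; rewrite !mxE.
      by case: (_ \in S); case: (_ \in S').
    rewrite -(ler_nat R) /g /agreement_sign.
    by case: (_ \in S); case: (_ \in S') => /=; lra.
  apply: le_trans.
  under eq_bigr do rewrite /g mulrCA.
  rewrite -mulr_sumr -/(G y i).
  apply: le_trans (ler_wpM2l _ Gyi); lra.
have /andP[norm_gt0 norm_le2] := @norm1_flip R _ _ x y i (x_neq i).
apply: le_ereal_sup_tmp; exists ((Defs.EM (p y) (w y) (p (flip y i)) (w (flip y i)) /
  norm1 (fun j => w y j - w (flip y i) j))%:E).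
  exists (w y), (w (flip y i)); split=> // eqw.
  move: norm_gt0; rewrite /norm1 big1 ?ltxx // => j _.
  by rewrite -/(w y) -/(w (flip y i)) eqw subrr normr0.
rewrite lee_fin ler_pdivlMr //.
(* It remains that [k / 8 <= (k - 1) / 4], which is [2 <= k]. *)
apply: le_trans (ler_wpM2l _ norm_le2) _; first lra.
lra.
Qed.

Theorem mainTheorem5 (R : realType) :
  exists (eps delta : R), 0 < eps /\ 0 < delta /\
  forall A : algorithm R, approx_algorithm eps A ->
  exists (c : R) (N : nat), 0 < c /\
  forall n : nat, (N <= n)%N ->
  exists Phi : cnf3 n, satisfiable Phi /\
    ((c * (n%:R `^ delta))%:E <= lipschitz_const A Phi)%E.
Proof.
exists 6^-1, 2^-1; rewrite !invr_gt0 !ltr0n; split=> //; split=> // A approx.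
(* [176 = 16 * 11], with 11 from [n_lt], and [112 = 28 * 2^2] makes [k = 2] admissible. *)
exists 176^-1, 112%N; rewrite invr_gt0 ltr0n; split=> // n n_ge.
have k_ex : exists k, (28 * k ^ 2 <= n)%N by exists 2%N.
have k_ub k : (28 * k ^ 2 <= n)%N -> (k <= n)%N by nia.
case: (ex_maxnP k_ex k_ub) => k kn kmax.
have k1 : (1 < k)%N by exact: (kmax 2).
have [Phi [Phi_sat LPhi]] := lipschitz_const_lower_bound R A k n approx k1 kn.
exists Phi; split=> //; apply: le_trans LPhi.
(* Maximality of [k] and [k >= 2] give [n < 28 (k + 1)^2 <= 63 k^2]. *)
have n_lt : (n <= (11 * k) ^ 2)%N.
  have : (n < 28 * k.+1 ^ 2)%N by rewrite ltnNge; apply/negP => /kmax; rewrite ltnn.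
  nia.
rewrite lee_fin powR12_sqrt //.
have : Num.sqrt n%:R <= 11 * k%:R :> R.
  rewrite -(@ger0_norm _ (11 * k%:R)); last by rewrite mulr_ge0.
  by rewrite -sqrtr_sqr ler_wsqrtr // -natrM -natrX ler_nat.
lra.
Qed.
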